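(* Let $\mathcal{H}$ be a complex Hilbert space and let $S,T\in\mathcal{L}(\mathcal{H})$ be positive operators such that $\mathcal{R}(T)$ is closed. Then $S\leq T$ if and only if $\rho(S^{1/2}T^\dagger S^{1/2})\leq 1$ and $\mathcal{R}(S^{1/2})\subseteq\mathcal{R}(T)$.
   Context: $\mathcal{L}(\mathcal{H})$ is the algebra of bounded linear operators on $\mathcal{H}$. Positive means self-adjoint and positive semidefinite; $\leq$ is the L\''owner order ($S\le T$ iff $T-S$ is positive); $\rho$ is the spectral radius; $T^\dagger$ is the Moore-Penrose inverse of the closed range operator $T$. *)

(* Defs.v *)
From HB Require Import structures.
From mathcomp Require Import all_boot all_order all_algebra.
From mathcomp Require Import complex.
From mathcomp Require Import all_classical all_reals topology normedtype.

Set Implicit Arguments.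
Unset Strict Implicit.
Unset Printing Implicit Defensive.

Import Order.TTheory GRing.Theory Num.Theory.
Import numFieldNormedType.Exports.

Local Open Scope classical_set_scope.
Local Open Scope ring_scope.
Local Open Scope complex_scope.

(* As everywhere in MathComp, forms of type [{dot H for Num.conj}] are linear
   in the first argument and conjugate-linear in the second one. The norm of
   an [R[i]]-normed module takes its values in [R[i]]. *)
HB.mixin Record CompleteNormedModule_isHilbert (R : realType) (H : Type)
    of CompleteNormedModule R[i] H := {
  inner : {dot H for (@Num.conj R[i])} ;
  sqr_norm_inner : forall x : H, `|x| ^+ 2 = inner x x }.

#[short(type="hilbertType")]
HB.structure Definition Hilbert (R : realType) :=
  {H of CompleteNormedModule_isHilbert R H & CompleteNormedModule R[i] H}.

Section Operators.
Context {R : realType} {H : hilbertType R}.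
Implicit Types (A B T S X Q : H -> H).

Definition bounded_operator : set (H -> H) :=
  [set A | linear A /\ exists M : R[i], forall x : H, `|A x| <= M * `|x|].

Definition self_adjoint A : Prop := forall x y, inner (A x) y = inner x (A y).

(* In [R[i]], [0 <= z] means that [z] is a nonnegative real number. *)
Definition positive_operator A : Prop :=
  [/\ bounded_operator A, self_adjoint A & forall x, 0 <= inner (A x) x].

Definition loewner_le S T : Prop := positive_operator (T \- S).

Definition is_sqrt S Q : Prop := positive_operator Q /\ Q \o Q = S.

(* [S^{1/2}]; the zero operator if [S] has no positive square root, which does
   not happen when [S] is positive. *)
Definition sqrt_operator S : H -> H := xget (fun=> 0) (is_sqrt S).

(* The Penrose equations. *)
Definition is_moore_penrose T X : Prop :=
  [/\ bounded_operator X,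
      T \o X \o T = T,
      X \o T \o X = X,
      self_adjoint (T \o X) &
      self_adjoint (X \o T)].

(* [T^\dagger]; the zero operator if [T] has no Moore-Penrose inverse, which
   does not happen when [T] is bounded with closed range. *)
Definition moore_penrose T : H -> H := xget (fun=> 0) (is_moore_penrose T).

Definition invertible_operator A : Prop :=
  exists2 B, bounded_operator B & A \o B = id /\ B \o A = id.

Definition spectrum A : set R[i] :=
  [set l | ~ invertible_operator (fun x => A x - l *: x)].

(* The spectrum of a bounded operator is bounded, and it is nonempty unless
   [H] is trivial, in which case the radius is [sup set0 = 0]. *)
Definition spectral_radius A : R := sup [set complex.Re `|l| | l in spectrum A].

End Operators.

(* Main.v *)
Require Import Defs.
From HB Require Import structures.
From mathcomp Require Import all_boot all_order all_algebra.
From mathcomp Require Import complex.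
From mathcomp Require Import all_classical all_reals topology normedtype.
From mathcomp Require Import sequences ring lra.
Import Order.TTheory GRing.Theory Num.Theory.
Import numFieldNormedType.Exports.
Local Open Scope classical_set_scope.
Local Open Scope ring_scope.

(* All estimates take place in the real inner product [rip x y = Re <x, y>] and
   in the real norm [nm]. Write [Q = S^{1/2}], [X = T^\dagger] and [A = Q X Q].

   A positive operator satisfies [rho(A) <= 1] iff [<A x, x> <= |x|^2]: in one
   direction the Cauchy-Schwarz inequality for the form [<A x, y>] gives
   [|A x| <= |x|]; in the other, the supremum [m] of [<A x, x> / |x|^2] belongs
   to the spectrum, since [|A x - m x|^2 <= K (m |x|^2 - <A x, x>)].

   If [S <= T], then [ker T] is contained in [ker Q], so [T X Q = Q]; for
   [y = X Q x] this gives
   [<A x, x> = <Q y, x> <= |Q y| |x|] and [|Q y|^2 <= <T y, y> = <A x, x>].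
   Conversely, if [T X Q = Q] and [u = Q x], [w = X Q u], then [T w = Q u], hence
   [|u|^4 = <T x, w>^2 <= <T x, x> <T w, w> = <T x, x> <A u, u>]. *)

(** * Linearity of functions that carry no bundled structure *)

Section LinearFunctions.
Set Implicit Arguments.
Unset Strict Implicit.
Context {K : pzRingType} {U V : lmodType K} {A : U -> V}.
Hypothesis linA : linear A.

Let A_linear : {linear U -> V} :=
  HB.pack A (GRing.isLinear.Build _ _ _ _ _ linA).

Lemma lin0 : A 0 = 0. Proof. exact: (linear0 A_linear). Qed.

Lemma linD x y : A (x + y) = A x + A y. Proof. exact: (linearD A_linear). Qed.

Lemma linB x y : A (x - y) = A x - A y. Proof. exact: (linearB A_linear). Qed.

Lemma linZ a x : A (a *: x) = a *: A x. Proof. exact: (linearZ_LR A_linear). Qed.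

End LinearFunctions.

(** * Real inner product and norm; Cauchy-Schwarz inequalities *)

Section RealStructure.
Set Implicit Arguments.
Unset Strict Implicit.
Context {R : realType} {H : hilbertType R}.
Implicit Types (x y z : H) (a r : R) (A : H -> H).
Local Open Scope complex_scope.

Definition nm x : R := complex.Re `|x|.

Definition rip x y : R := complex.Re (inner x y).

Lemma normE x : `|x| = (nm x)%:C.
Proof. by rewrite /nm RRe_real // normr_real. Qed.

Lemma nm_ge0 x : 0 <= nm x.
Proof. by rewrite -ler0c -normE. Qed.

Lemma nm_eq0 x : (nm x == 0) = (x == 0).
Proof. by rewrite -(inj_eq (@complexI R)) -normE normr_eq0. Qed.

Lemma nm_le_norm x r : (nm x <= r) = (`|x| <= r%:C).
Proof. by rewrite normE lecR. Qed.

Lemma nm0 : nm 0 = 0.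
Proof. by rewrite /nm normr0. Qed.

Lemma nmN x : nm (- x) = nm x.
Proof. by rewrite /nm normrN. Qed.

Lemma nmB x y : nm (x - y) = nm (y - x).
Proof. by rewrite /nm distrC. Qed.

Lemma nmD x y : nm (x + y) <= nm x + nm y.
Proof. by rewrite nm_le_norm rmorphD /= -!normE ler_normD. Qed.

Lemma nmZ (l : R[i]) x : nm (l *: x) = complex.Re `|l| * nm x.
Proof.
by rewrite /nm normrZ -{1}(RRe_real (normr_real x)) -{1}(RRe_real (normr_real l))
  -rmorphM.
Qed.

Lemma nmZr a x : nm (a%:C *: x) = `|a| * nm x.
Proof. by rewrite nmZ normc_def /= expr0n /= addr0 sqrtr_sqr. Qed.

Lemma ripxx x : rip x x = nm x ^+ 2.
Proof. by rewrite /rip -sqr_norm_inner normE -rmorphXn. Qed.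

Lemma ripC x y : rip x y = rip y x.
Proof.
by rewrite /rip hermC /= expr0 mul1r; case: (inner y x).
Qed.

Lemma ripDl x y z : rip (x + y) z = rip x z + rip y z.
Proof. by rewrite /rip linearDl raddfD. Qed.

Lemma ripDr x y z : rip z (x + y) = rip z x + rip z y.
Proof. by rewrite /rip linearDr raddfD. Qed.

Lemma ripNl x y : rip (- x) y = - rip x y.
Proof. by rewrite /rip linearNl raddfN. Qed.

Lemma ripNr x y : rip x (- y) = - rip x y.
Proof. by rewrite /rip linearNr raddfN. Qed.

Lemma ripBl x y z : rip (x - y) z = rip x z - rip y z.
Proof. by rewrite ripDl ripNl. Qed.

Lemma ripBr x y z : rip z (x - y) = rip z x - rip z y.
Proof. by rewrite ripDr ripNr. Qed.

Lemma ripZl a x y : rip (a%:C *: x) y = a * rip x y.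
Proof.
rewrite /rip linearZl_LR /=; case: (inner x y) => u v /=; by rewrite mul0r subr0.
Qed.

Lemma ripZr a x y : rip x (a%:C *: y) = a * rip x y.
Proof. by rewrite ripC ripZl ripC. Qed.

Lemma rip0l x : rip 0 x = 0.
Proof. by rewrite /rip linear0l. Qed.

Lemma rip0r x : rip x 0 = 0.
Proof. by rewrite ripC rip0l. Qed.

Lemma rip_ext x y : (forall z, rip x z = rip y z) -> x = y.
Proof.
move=> xy; apply/eqP; rewrite -subr_eq0 -nm_eq0 -sqrf_eq0 -ripxx.
by rewrite ripBl xy subrr.
Qed.

Lemma Im_inner x y : complex.Im (inner x y) = - rip ('i *: x) y.
Proof. by rewrite /rip linearZl_LR /=; case: (inner x y) => u v /=; ring. Qed.

Lemma CauchySchwarz_form A x y : linear A ->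
  (forall x y, rip (A x) y = rip x (A y)) -> (forall x, 0 <= rip (A x) x) ->
  rip (A x) y ^+ 2 <= rip (A x) x * rip (A y) y.
Proof.
move=> linA symA posA.
have quad (s t : R) : 0 <= s ^+ 2 * rip (A x) x + 2 * (s * t) * rip (A x) y
    + t ^+ 2 * rip (A y) y.
  have := posA (s%:C *: x + t%:C *: y).
  have -> : A (s%:C *: x + t%:C *: y) = s%:C *: A x + t%:C *: A y.
    by rewrite linA (linZ linA).
  rewrite !(ripDl, ripDr, ripZl, ripZr).
  have -> : rip (A y) x = rip (A x) y by rewrite symA ripC.
  by move=> /le_trans; apply; rewrite le_eqVlt; apply/orP; left; apply/eqP; ring.
move: (posA x) (posA y) quad.
set p := rip (A x) x; set q := rip (A x) y; set r := rip (A y) y => p0 r0 quad.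
(* The choice [s = r], [t = - q] gives [0 <= r * (p * r - q ^+ 2)]. *)
have [r_gt0|r_le0] := ltP 0 r; first by have := quad r (- q); nra.
have r_eq0 : r = 0 by apply/le_anti; rewrite r_le0 r0.
rewrite r_eq0.
have [->|q0] := eqVneq q 0; first by nra.
(* With [r = 0] and [q != 0] the form is affine in [t] at [s = 1]; this [t] gives it the value
   -1. *)
have := quad 1 (- (p + 1) / (2 * q)).
rewrite r_eq0 => h.
have : 2 * (1 * (- (p + 1) / (2 * q))) * q = - (p + 1) by field.
by move: h => /[swap] ->; lra.
Qed.

Lemma CauchySchwarz_rip x y : rip x y ^+ 2 <= nm x ^+ 2 * nm y ^+ 2.
Proof.
rewrite -!ripxx; apply: (@CauchySchwarz_form id) => // z.
by rewrite ripxx sqr_ge0.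
Qed.

Lemma rip_le_nm x y : `|rip x y| <= nm x * nm y.
Proof.
rewrite -ler_sqr ?nnegrE ?mulr_ge0 ?nm_ge0 //.
by rewrite real_normK ?num_real // exprMn CauchySchwarz_rip.
Qed.

(** The imaginary part of <x, y> is minus the real inner product of ['i *: x] with [y], so complex
    linearity extends real symmetry to the complex form. *)
Lemma self_adjointP A : linear A ->
  self_adjoint A <-> forall x y, rip (A x) y = rip x (A y).
Proof.
move=> linA; split=> [sA x y|sA x y]; first by rewrite /rip sA.
apply/eqP; rewrite eq_complex -/(rip _ _) sA -/(rip _ _) eqxx /=.
by rewrite !Im_inner -linZ // sA.
Qed.

Lemma bounded_operatorP A : bounded_operator A <->
  linear A /\ exists2 M : R, 0 < M & forall x, nm (A x) <= M * nm x.
Proof.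
split=> [[linA [M AM]]|[linA [M M0 AM]]]; split=> //; last first.
  by exists M%:C => x; rewrite !normE -rmorphM lecR; exact: AM.
exists (complex.Re `|M| + 1).
  have : 0 <= complex.Re `|M| by rewrite -ler0c RRe_real // normr_real.
  lra.
move=> x; rewrite nm_le_norm rmorphM /= -normE rmorphD /= (RRe_real (normr_real M)).
have [->|x0] := eqVneq x 0; first by rewrite lin0 // normr0 mulr0.
have nx : 0 < `|x| by rewrite normr_gt0.
apply: le_trans (AM x) _; rewrite ler_pM2r //.
(* A nonzero vector forces the complex bound [M] to be a nonnegative real. *)
have M0 : 0 <= M by have := le_trans (normr_ge0 _) (AM x); rewrite pmulr_lge0.
by rewrite ger0_norm // lerDl ler01.
Qed.

(** Nonnegativity in [R[i]] also demands a zero imaginary part; self-adjointness supplies it, so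
    real data suffice. *)
Lemma positive_operatorP A : positive_operator A <->
  [/\ linear A, exists2 M : R, 0 < M & forall x, nm (A x) <= M * nm x,
      forall x y, rip (A x) y = rip x (A y) & forall x, 0 <= rip (A x) x].
Proof.
split=> [[/bounded_operatorP[linA bA] sA pA]|[linA bA sA pA]].
  split=> //; first exact/self_adjointP.
  by move=> x; move: (pA x); rewrite /rip lecE => /andP[].
have sA' : self_adjoint A by exact/self_adjointP.
split=> // [|x]; first exact/bounded_operatorP.
rewrite lecE pA andbT eq_sym.
have := sA' x x; rewrite [RHS]hermC /= expr0 mul1r.
by case: (inner (A x) x) => u v [] /= vN; apply/eqP; lra.
Qed.

(** Cauchy-Schwarz for the form of [A] at the pair [x], [A x] gives |A x|^4 <= <A x, x> <A (A x), A
    x>, and the last factor is at most K |A x|^2. *)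
Lemma nm_sqr_le_form A (K : R) : linear A ->
  (forall x y, rip (A x) y = rip x (A y)) -> (forall x, 0 <= rip (A x) x) ->
  0 <= K -> (forall x, rip (A x) x <= K * nm x ^+ 2) ->
  forall x, nm (A x) ^+ 2 <= K * rip (A x) x.
Proof.
move=> linA symA posA K0 AK x.
have := CauchySchwarz_form x (A x) linA symA posA; rewrite ripxx.
have := AK (A x); have := posA x; have := sqr_ge0 (nm (A x)).
set t := nm (A x) ^+ 2; set p := rip (A x) x => t0 p0 h1 h2.
have {h2} : t * t <= K * p * t.
  rewrite -expr2 (le_trans h2) // [K * p]mulrC -mulrA.
  by rewrite ler_wpM2l.
have [->|t_neq0] := eqVneq t 0; first by rewrite mulr_ge0.
by rewrite ler_pM2r // lt_def t_neq0.
Qed.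

Lemma nm_le_of_form A (K : R) : linear A ->
  (forall x y, rip (A x) y = rip x (A y)) -> (forall x, 0 <= rip (A x) x) ->
  0 <= K -> (forall x, rip (A x) x <= K * nm x ^+ 2) ->
  forall x, nm (A x) <= K * nm x.
Proof.
move=> linA symA posA K0 AK x.
rewrite -ler_sqr ?nnegrE ?mulr_ge0 ?nm_ge0 //.
apply: le_trans (nm_sqr_le_form linA symA posA K0 AK x) _.
by rewrite exprMn expr2 -mulrA ler_wpM2l.
Qed.

End RealStructure.

(** * Limits in norm and convergence criteria *)

Section Limits.
Set Implicit Arguments.
Unset Strict Implicit.
Context {R : realType} {H : hilbertType R}.
Implicit Types (u v : nat -> H) (x y l : H) (A : H -> H).
Local Open Scope complex_scope.

Lemma cvg_nmP u l : (u @ \oo --> l) <->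
  forall e : R, 0 < e -> exists N, forall n, (N <= n)%N -> nm (u n - l) < e.
Proof.
split=> [/cvgrPdist_lt ul e e0|ul].
  have /ul[N _ uN] : 0 < e%:C :> R[i] by rewrite ltcR.
  by exists N => n /uN; rewrite normE ltcR nmB.
apply/cvgrPdist_lt => e; rewrite ltcE => /andP[/eqP Ie0 Re0].
have [N uN] := ul _ Re0; exists N => // n /uN.
by rewrite normE ltcE /= nmB => ->; rewrite Ie0 eqxx.
Qed.

Lemma nm_lim_le u l y (r : R) N : u @ \oo --> l ->
  (forall n, (N <= n)%N -> nm (u n - y) <= r) -> nm (l - y) <= r.
Proof.
move=> /cvg_nmP ul uy; apply/ler_addgt0Pr => e e0.
have [M uM] := ul _ e0; set n := maxn N M.
have -> : l - y = (u n - y) - (u n - l) by rewrite opprB [RHS]addrC subrKA.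
apply: le_trans (nmD _ _) _; rewrite nmN lerD ?uy ?leq_maxl //.
by apply/ltW/uM/leq_maxr.
Qed.

Lemma cvg_hilbert_unique u x y : u @ \oo --> x -> u @ \oo --> y -> x = y.
Proof. exact: (@cvg_unique _ (@norm_hausdorff _ H)). Qed.

Lemma cvg_bounded_operator A (M : R) u l : linear A ->
  (forall x, nm (A x) <= M * nm x) -> u @ \oo --> l -> A (u n) @[n --> \oo] --> A l.
Proof.
move=> linA AM /cvg_nmP ul; apply/cvg_nmP => e e0.
have M0 : 0 < `|M| + 1 by rewrite ltr_wpDl.
have [N uN] := ul _ (divr_gt0 e0 M0); exists N => n /uN.
rewrite ltr_pdivlMr // -linB //; apply: le_lt_trans.
apply: le_trans (AM _) _; rewrite mulrC ler_wpM2l ?nm_ge0 //.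
by rewrite (le_trans (ler_norm _)) // lerDl.
Qed.

Lemma cvg_rip u l y : u @ \oo --> l -> rip (u n) y @[n --> \oo] --> rip l y.
Proof.
move=> /cvg_nmP ul; apply/cvgrPdist_lt => e e0.
have M0 : 0 < nm y + 1 by rewrite ltr_wpDl // nm_ge0.
have [N uN] := ul _ (divr_gt0 e0 M0); exists N => // n /uN.
rewrite ltr_pdivlMr // distrC -ripBl; apply: le_lt_trans.
apply: le_trans (rip_le_nm _ _) _; rewrite ler_wpM2l ?nm_ge0 //.
by rewrite lerDl.
Qed.

(** The scalars [c n] increase to their supremum, so once [c N] is close to it all later increments
    are small and completeness applies. *)
Lemma cvg_of_sqr_increments u (c : nat -> R) (M : R) : (forall n, c n <= M) ->
  (forall m n, (m <= n)%N -> nm (u n - u m) ^+ 2 <= c n - c m) ->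
  exists l, u @ \oo --> l.
Proof.
move=> cM uc; have hs : has_sup (range c).
  by split; [exists (c 0%N), 0%N | exists M => _ [n _ <-]].
suff : cvg (u @ \oo) by move=> ul; exists (lim (u @ \oo)).
apply/cauchy_cvgP/cauchyP => e e0.
have [Ie0 Re0] : complex.Im e = 0 /\ 0 < complex.Re e.
  by move: e0; rewrite ltcE => /andP[/eqP ? ?]; split.
have [_ [N _ <-] cN] := sup_adherent (exprn_gt0 2 Re0) hs.
exists (u N), N => // n Nn; rewrite -ball_normE /= normE ltcE /= Ie0 eqxx /=.
rewrite nmB -ltr_sqr ?nnegrE ?nm_ge0 ?(ltW Re0) //.
apply: le_lt_trans (uc _ _ Nn) _.
have : c n <= sup (range c) by apply: ub_le_sup; [case: hs | exists n].
lra.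
Qed.

Lemma nm_telescope u (c : nat -> R) :
  (forall n, nm (u n.+1 - u n) <= c n.+1 - c n) ->
  forall m n, (m <= n)%N -> nm (u n - u m) <= c n - c m.
Proof.
move=> uc m n /subnK <-; elim: (n - m)%N => [|k IHk].
  by rewrite add0n !subrr nm0.
rewrite addSn -(subrKA (u (k + m)%N)).
by apply: le_trans (nmD _ _) _; have := uc (k + m)%N; lra.
Qed.

Lemma cvg_of_increments u (c : nat -> R) (M : R) : (forall n, c n <= M) ->
  (forall n, nm (u n.+1 - u n) <= c n.+1 - c n) ->
  exists2 l, u @ \oo --> l & forall n, nm (l - u n) <= M - c n.
Proof.
move=> cM uc; have uc' := nm_telescope uc.
(* The square of [c n - c m] is at most [(M - c 0) * (c n - c m)], which yields the squared form of
   the hypothesis. *)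
have [] := @cvg_of_sqr_increments u (fun n => (M - c 0%N) * c n) ((M - c 0%N) * M).
- move=> n; rewrite ler_wpM2l ?subr_ge0 //.
- move=> m n mn; rewrite -mulrBr expr2 ler_pM ?nm_ge0 ?uc' //.
  apply: le_trans (uc' _ _ mn) _; apply: lerB => //.
  by have := le_trans (nm_ge0 _) (uc' _ _ (leq0n m)); rewrite subr_ge0.
move=> l ul; exists l => // n; apply: (nm_lim_le (N := n) ul) => k nk.
by apply: le_trans (uc' _ _ nk) _; rewrite lerB.
Qed.

End Limits.

(** * Spectrum and spectral radius *)

Section SpectralRadius.
Set Implicit Arguments.
Unset Strict Implicit.
Context {R : realType} {H : hilbertType R}.
Implicit Types (x y z : H) (A B : H -> H).
Local Open Scope complex_scope.

Lemma invertible_of_bounded_below A (k : R) : linear A -> 0 < k ->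
  (forall x, k * nm x <= nm (A x)) -> (forall z, exists x, A x = z) ->
  invertible_operator A.
Proof.
move=> linA k0 kA /choice[B AB].
have injA x y : A x = A y -> x = y.
  move=> Axy; apply/eqP; rewrite -subr_eq0 -nm_eq0 eq_le nm_ge0 andbT.
  by have := kA (x - y); rewrite linB // Axy subrr nm0 pmulr_rle0.
exists B; last by split; apply/funext => x //=; apply: injA; rewrite AB.
apply/bounded_operatorP; split.
  by move=> a x y; apply: injA; rewrite linA !AB.
exists k^-1; first by rewrite invr_gt0.
by move=> x; rewrite ler_pdivlMl // -{2}(AB x).
Qed.

(** Fixed-point iteration for [y |-> z + B y]; partial sums of a geometric series control the
    increments. *)
Lemma one_sub_contraction_surj B (q : R) : linear B -> 0 <= q -> q < 1 ->
  (forall x, nm (B x) <= q * nm x) -> forall z, exists x, x - B x = z.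
Proof.
move=> lin_B q0 q1 Bq z.
pose u n := iter n (fun y => z + B y) 0.
pose c n := (1 - q ^+ n) / (1 - q) * nm z.
have q1' : 0 < 1 - q by rewrite subr_gt0.
have uS n : nm (u n.+1 - u n) <= q ^+ n * nm z.
  elim: n => [|n IHn]; first by rewrite /u /= lin0 // addr0 subr0 mul1r.
  have -> : u n.+2 - u n.+1 = B (u n.+1 - u n).
    by rewrite /u /= linB // opprD addrACA subrr add0r.
  by apply: le_trans (Bq _) _; rewrite exprS -mulrA ler_wpM2l.
have [] := @cvg_of_increments _ _ u c (nm z / (1 - q)).
- move=> n; rewrite /c mulrAC ler_pdivrMr // mulfVK ?gt_eqF //.
  by rewrite ler_piMl ?nm_ge0 // lerBlDr lerDl exprn_ge0.
- move=> n; apply: le_trans (uS n) _; rewrite /c -mulrBl -mulrBl.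
  rewrite ler_wpM2r ?nm_ge0 // ler_pdivlMr // exprS; lra.
move=> l ul _; exists l.
have u1 : u n.+1 @[n --> \oo] --> l by rewrite cvg_shiftS.
have u2 : u n.+1 @[n --> \oo] --> z + B l.
  by apply: cvgD; [exact: cvg_cst | exact: cvg_bounded_operator Bq ul].
by apply/eqP; rewrite subr_eq; apply/eqP; exact: cvg_hilbert_unique u1 u2.
Qed.

(** For |l| > r the operator A - l is bounded below by |l| - r, and it is onto since it equals -l (1
    - l^-1 A) with l^-1 A a strict contraction. *)
Lemma spectrum_le A (r : R) (l : R[i]) : linear A -> 0 <= r ->
  (forall x, nm (A x) <= r * nm x) -> spectrum A l -> complex.Re `|l| <= r.
Proof.
move=> linA r0 Ar; apply: contra_notP => /negP; rewrite -ltNge => rl.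
have l0 : l != 0 by apply: contraTneq rl => ->; rewrite normr0 /= -leNgt.
have linAl : linear (fun x => A x - l *: x).
  move=> a x y; rewrite linA scalerDr scalerBr opprD addrACA !scalerA.
  by rewrite [l * a]mulrC.
apply: (@invertible_of_bounded_below _ (complex.Re `|l| - r)) => //.
- by rewrite subr_gt0.
- move=> x; have := nmD (A x) (l *: x - A x); rewrite subrKC nmZ nmB.
  have := Ar x; lra.
- pose B x := l^-1 *: A x.
  have lin_B : linear B.
    by move=> a x y; rewrite /B linA scalerDr !scalerA [l^-1 * a]mulrC.
  have l0' : 0 < complex.Re `|l| by exact: le_lt_trans rl.
  have nmV x : nm (l^-1 *: x) = nm x / complex.Re `|l|.
    apply: (mulIf (lt0r_neq0 l0')).
    by rewrite mulrC -nmZ scalerA divff // scale1r mulfVK ?gt_eqF.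
  have Bq x : nm (B x) <= r / complex.Re `|l| * nm x.
    by rewrite /B nmV mulrAC ler_wpM2r // invr_ge0 ltW.
  have q0 : 0 <= r / complex.Re `|l| by rewrite divr_ge0 // ltW.
  have q1 : r / complex.Re `|l| < 1 by rewrite ltr_pdivrMr // mul1r.
  move=> z; have [x xB] := one_sub_contraction_surj lin_B q0 q1 Bq (- (l^-1 *: z)).
  exists x; have -> : A x = l *: B x by rewrite /B scalerA divff // scale1r.
  by rewrite -scalerBr -opprB xB opprK scalerA divff // scale1r.
Qed.

(** A bounded inverse of A - m would make the form m |x|^2 - <A x, x> coercive, although it gets
    arbitrarily small relative to |x|^2. *)
Lemma spectrum_sup_form A (m : R) : positive_operator A ->
  (forall x, rip (A x) x <= m * nm x ^+ 2) ->
  (forall e, 0 < e -> exists x, (m - e) * nm x ^+ 2 < rip (A x) x) ->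
  spectrum A m%:C.
Proof.
move=> /positive_operatorP[linA [M M0 AM] symA posA] Am mA [B bB [_ BC]].
have {bB} /bounded_operatorP[lin_B [b b0 Bb]] := bB.
pose C x := m%:C *: x - A x.
have linC : linear C.
  move=> a x y; rewrite /C linA scalerDr scalerBr opprD addrACA !scalerA.
  by rewrite [m%:C * a]mulrC.
have symC x y : rip (C x) y = rip x (C y).
  by rewrite /C !(ripBl, ripBr, ripZl, ripZr) symA.
have formC x : rip (C x) x = m * nm x ^+ 2 - rip (A x) x.
  by rewrite /C ripBl ripZl ripxx.
have posC x : 0 <= rip (C x) x by rewrite formC subr_ge0.
pose K := `|m| + 1.
have K0 : 0 < K by rewrite ltr_wpDl.
have CK x : rip (C x) x <= K * nm x ^+ 2.
  rewrite formC lerBlDr ler_wpDr // ler_wpM2r ?sqr_ge0 //.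
  by rewrite (le_trans (ler_norm _)) // lerDl.
have coercive x : nm x ^+ 2 <= b ^+ 2 * K * rip (C x) x.
  rewrite -mulrA.
  apply: le_trans (_ : _ <= b ^+ 2 * nm (C x) ^+ 2) _; last first.
    by rewrite ler_wpM2l ?sqr_ge0 //; apply: nm_sqr_le_form => //; exact: ltW.
  rewrite -exprMn ler_sqr ?nnegrE ?mulr_ge0 ?nm_ge0 ?(ltW b0) //.
  have {1}-> : x = B (A x - m%:C *: x) by rewrite -[LHS](congr1 (@^~ x) BC).
  by rewrite nmB in Bb * => //; apply: le_trans (Bb _) _.
have D0 : 0 < b ^+ 2 * K by rewrite mulr_gt0 // exprn_gt0.
have iD0 : 0 < (b ^+ 2 * K)^-1 by rewrite invr_gt0.
(* The coercivity constant is 1 / (b^2 K), so this tolerance gives the contradiction. *)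
have [x] := mA _ iD0.
apply/negP; rewrite -leNgt.
have := coercive x; rewrite formC -ler_pdivrMl //; lra.
Qed.

Lemma spectral_radius_le A (r : R) : positive_operator A -> 0 <= r ->
  (spectral_radius A <= r <-> forall x, rip (A x) x <= r * nm x ^+ 2).
Proof.
move=> pA r0; have /positive_operatorP[linA [M M0 AM] symA posA] := pA.
split=> [rho_r x|Ar]; last first.
  have ub : ubound [set complex.Re `|l| | l in spectrum A] r.
    by move=> _ [l sl <-]; apply: spectrum_le sl => //; exact: nm_le_of_form.
  rewrite /spectral_radius; set E := [set _ | _ in _] in ub *.
  (* The [sup] of an empty set is 0 by convention, hence at most [r]. *)
  have [->|E0] := eqVneq E set0; first by rewrite sup0.
  by apply: ge_sup => //; exact/set0P.
apply: contrapT => /negP; rewrite -ltNge => xr.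
(* The Rayleigh quotients; their supremum is the spectral value that exceeds [r]. *)
pose E := [set rip (A x) x / nm x ^+ 2 | x in [set x | x != 0]].
have nm2 y : y != 0 -> 0 < nm y ^+ 2.
  by move=> y0; rewrite exprn_gt0 // lt_def nm_ge0 nm_eq0 y0.
have x0 : x != 0.
  by apply: contraTneq xr => ->; rewrite nm0 rip0r expr0n mulr0 ltxx.
have hsE : has_sup E.
  split; first by exists (rip (A x) x / nm x ^+ 2), x.
  exists M => _ [y y0 <-]; rewrite ler_pdivrMr ?nm2 //.
  apply: le_trans (ler_norm _) _; apply: le_trans (rip_le_nm _ _) _.
  by rewrite expr2 mulrA ler_wpM2r ?nm_ge0.
have m_sup y : rip (A y) y <= sup E * nm y ^+ 2.
  have [->|y0] := eqVneq y 0; first by rewrite nm0 rip0r expr0n mulr0.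
  rewrite -ler_pdivrMr ?nm2 //; apply: ub_le_sup; first by case: hsE.
  by exists y.
have m_spec : spectrum A (sup E)%:C.
  apply: spectrum_sup_form => // e e0.
  have [_ [y y0 <-]] := sup_adherent e0 hsE.
  by rewrite ltr_pdivlMr ?nm2 // => ?; exists y.
have : sup E <= spectral_radius A.
  apply: le_trans (ler_norm _) _; apply: ub_le_sup.
    by exists M => _ [l sl <-]; apply: spectrum_le sl => //; exact: ltW.
  by exists (sup E)%:C => //; rewrite normc_def /= expr0n /= addr0 sqrtr_sqr.
apply/negP; rewrite -ltNge (le_lt_trans rho_r) //.
by rewrite -(ltr_pM2r (nm2 _ x0)) (lt_le_trans xr).
Qed.

End SpectralRadius.

(** * Existence of the positive square root *)

Section SquareRoot.
Set Implicit Arguments.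
Unset Strict Implicit.
Context {R : realType} {H : hilbertType R}.
Implicit Types (x y z : H) (A B S : H -> H).
Local Open Scope complex_scope.

(* The recursion [Y_{n+1} = (B + Y_n^2) / 2] is dominated by its scalar analogue
   [c_{n+1} = (1 + c_n^2) / 2], so it converges to some [L] with
   [L = (B + L^2) / 2]; this says that [(1 - L)^2 = 1 - B]. *)
Lemma sqrt_one_sub_contraction B : linear B ->
  (forall x y, rip (B x) y = rip x (B y)) -> (forall x, nm (B x) <= nm x) ->
  exists2 Q, positive_operator Q & forall x, Q (Q x) = x - B x.
Proof.
move=> linB' symB B1.
pose Y n := iter n (fun (Y : H -> H) x => (2^-1)%:C *: (B x + Y (Y x))) (fun=> 0).
pose c n : R := iter n (fun a => (1 + a ^+ 2) / 2) 0.
have cS n : c n.+1 = (1 + c n ^+ 2) / 2 by [].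
have YS n x : Y n.+1 x = (2^-1)%:C *: (B x + Y n (Y n x)) by [].
have c01 n : 0 <= c n <= 1.
  by elim: n => [|n /andP[c0 c1]]; [rewrite /c /= lexx ler01 | rewrite cS; nra].
have half (x : H) : nm ((2^-1)%:C *: x) = nm x / 2.
  by rewrite nmZr ger0_norm ?invr_ge0 // mulrC.
have linY n : linear (Y n).
  elim: n => [|n IHn] a x y; first by rewrite /Y /= scaler0 addr0.
  rewrite !YS !IHn linB' addrACA -[in LHS]scalerDr [LHS]scalerDr.
  by rewrite !scalerA mulrC.
have symY n x y : rip (Y n x) y = rip x (Y n y).
  elim: n x y => [|n IHn] x y; first by rewrite /Y /= rip0l rip0r.
  by rewrite !YS !(ripZl, ripZr, ripDl, ripDr) symB !IHn.
have Yc n x : nm (Y n x) <= c n * nm x.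
  elim: n x => [|n IHn] x; first by rewrite /Y /= nm0 mul0r.
  rewrite YS cS half mulrAC ler_wpM2r ?invr_ge0 // mulrDl mul1r.
  apply: le_trans (nmD _ _) (lerD (B1 x) _).
  have /andP[c0 _] := c01 n.
  by apply: le_trans (IHn _) _; rewrite expr2 -mulrA ler_wpM2l.
have dY n x : nm (Y n.+1 x - Y n x) <= c n.+1 * nm x - c n * nm x.
  elim: n x => [|n IHn] x.
    rewrite [Y 0%N x]/(0 : H) subr0 [c 0%N]/(0 : R) mul0r subr0; exact: Yc.
  (* Splitting Y_{n+1}^2 - Y_n^2 as Y_{n+1} (Y_{n+1} - Y_n) + (Y_{n+1} - Y_n) Y_n avoids commutation
     and mirrors c_{n+1}^2 - c_n^2. *)
  have -> : Y n.+2 x - Y n.+1 x = (2^-1)%:C *: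
      (Y n.+1 (Y n.+1 x - Y n x) + (Y n.+1 (Y n x) - Y n (Y n x))).
    rewrite [Y n.+2 x]YS [in LHS](YS n x) -scalerBr opprD addrACA subrr add0r.
    by rewrite (linB (linY n.+1)) subrKA.
  rewrite half ler_pdivrMr //; apply: le_trans (nmD _ _) _.
  have h1 := Yc n.+1 (Y n.+1 x - Y n x).
  have /andP[c0 _] := c01 n.+1; have h2 := ler_wpM2l c0 (IHn x).
  have h3 := IHn (Y n x).
  have h4 : (c n.+1 - c n) * nm (Y n x) <= (c n.+1 - c n) * (c n * nm x).
    apply: ler_wpM2l (Yc _ _).
    by rewrite cS; have := sqr_ge0 (1 - c n); lra.
  have -> : c n.+2 = (1 + c n.+1 ^+ 2) / 2 by [].
  have E : c n.+1 * nm x = (1 + c n ^+ 2) / 2 * nm x by rewrite cS.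
  lra.
have Ycvg (x : H) : exists l : H, Y n x @[n --> \oo] --> l.
  have [] := @cvg_of_increments _ _ (Y ^~ x) (fun n => c n * nm x) (nm x).
  - by move=> n; rewrite ler_piMl ?nm_ge0 //; have /andP[] := c01 n.
  - by move=> n; exact: dY.
  by move=> l Yl _; exists l.
have [L YL] := choice Ycvg.
have linL : linear L.
  move=> a x y; apply: cvg_hilbert_unique (YL _) _.
  rewrite (_ : (fun n => Y n _) = fun n => a *: Y n x + Y n y); last first.
    by apply/funext => n; rewrite linY.
  by apply: cvgD (YL y); apply: cvgZr.
have symL x y : rip (L x) y = rip x (L y).
  apply: (@cvg_unique _ (@norm_hausdorff _ R)) (cvg_rip (YL x)) _.
  rewrite (_ : (fun n => rip _ _) = fun n => rip (Y n y) x); last first.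
    by apply/funext => n; rewrite symY ripC.
  by rewrite ripC; exact: cvg_rip.
have Y1 n x : nm (Y n x) <= nm x.
  by apply: le_trans (Yc _ _) _; rewrite ler_piMl ?nm_ge0 //; case/andP: (c01 n).
have L1 x : nm (L x) <= nm x.
  by rewrite -[L x]subr0; apply: (nm_lim_le (N := 0%N) (YL x)) => n _; rewrite subr0.
have YYL x : Y n (Y n x) @[n --> \oo] --> L (L x).
  apply/cvg_nmP => e e0.
  have e20 : 0 < e / 2 by rewrite divr_gt0.
  have /cvg_nmP/(_ _ e20)[N1 h1] := YL x; have /cvg_nmP/(_ _ e20)[N2 h2] := YL (L x).
  exists (maxn N1 N2) => n; rewrite geq_max => /andP[/h1 {}h1 /h2 {}h2].
  rewrite -(subrKA (Y n (L x))) -linB //.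
  by have := nmD (Y n (Y n x - L x)) (Y n (L x) - L (L x)); have := Y1 n (Y n x - L x); lra.
have LE x : L x = (2^-1)%:C *: (B x + L (L x)).
  have YL' : Y n.+1 x @[n --> \oo] --> L x by rewrite (cvg_shiftS (Y ^~ x)).
  apply: cvg_hilbert_unique YL' _.
  by apply: cvgZr; apply: cvgD (YYL x); exact: cvg_cst.
have two_LE x : L x + L x = B x + L (L x).
  rewrite -[RHS]scale1r; have -> : (1 : R[i]) = (2^-1)%:C + (2^-1)%:C.
    by rewrite -rmorphD -[LHS]/((1 : R)%:C); congr (_%:C); lra.
  by rewrite scalerDl -!LE.
(* The root is 1 - L; its positivity follows from |L x| <= |x|. *)
exists (fun x => x - L x); last first.
  move=> x /=; rewrite (linB linL) opprB -addrA; congr (_ + _).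
  by rewrite addrCA -opprD two_LE opprD addrCA subrr addr0.
apply/positive_operatorP; split.
- by move=> a x y; rewrite linL scalerBr opprD addrACA.
- by exists 2 => // x; have := nmD x (- L x); rewrite nmN; have := L1 x; lra.
- by move=> x y; rewrite ripBl ripBr symL.
- move=> x; rewrite ripBl ripxx subr_ge0.
  apply: le_trans (ler_norm _) _; apply: le_trans (rip_le_nm _ _) _.
  by rewrite expr2 ler_wpM2r ?nm_ge0.
Qed.

(** For a bound [M] of [S], the operator 1 - S / M is a contraction; the root obtained for S / M is
    rescaled by the square root of [M]. *)
Lemma positive_sqrt_exists S : positive_operator S -> exists Q, is_sqrt S Q.
Proof.
move=> /positive_operatorP[linS [M M0 SM] symS posS].
pose C x := (M^-1)%:C *: S x; pose B x := x - C x.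
have M'0 : 0 <= M^-1 by rewrite invr_ge0 ltW.
have linC : linear C.
  by move=> a x y; rewrite /C linS scalerDr !scalerA mulrC.
have linB' : linear B.
  by move=> a x y; rewrite /B linC scalerBr opprD addrACA.
have symB x y : rip (B x) y = rip x (B y).
  by rewrite /B !(ripBl, ripBr) /C ripZl ripZr symS.
have formB x : rip (B x) x = nm x ^+ 2 - M^-1 * rip (S x) x.
  by rewrite /B ripBl ripxx /C ripZl.
have SM' x : rip (S x) x <= M * nm x ^+ 2.
  apply: le_trans (ler_norm _) _; apply: le_trans (rip_le_nm _ _) _.
  by rewrite expr2 mulrA ler_wpM2r ?nm_ge0.
have B1 x : nm (B x) <= nm x.
  rewrite -[leRHS]mul1r; apply: nm_le_of_form => // y; rewrite formB.
    by rewrite subr_ge0 mulrC ler_pdivrMr // mulrC.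
  by rewrite mul1r lerBlDr lerDl mulr_ge0.
have [Q /positive_operatorP[linQ [K K0 QK] symQ posQ] QQ] :=
  sqrt_one_sub_contraction linB' symB B1.
have sM : (Num.sqrt M)%:C * (Num.sqrt M)%:C = M%:C :> R[i].
  by rewrite -rmorphM -expr2 sqr_sqrtr // ltW.
exists (fun x => (Num.sqrt M)%:C *: Q x); split.
  apply/positive_operatorP; split.
  - by move=> a x y; rewrite linQ scalerDr !scalerA mulrC.
  - exists (Num.sqrt M * K); first by rewrite mulr_gt0 // sqrtr_gt0.
    move=> x; rewrite nmZr ger0_norm ?sqrtr_ge0 // -mulrA.
    by rewrite ler_wpM2l // sqrtr_ge0.
  - by move=> x y; rewrite ripZl ripZr symQ.
  - by move=> x; rewrite ripZl mulr_ge0 // sqrtr_ge0.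
apply/funext => x /=; rewrite (linZ linQ) QQ /B subKr /C !scalerA sM.
by rewrite -rmorphM divff ?lt0r_neq0 // scale1r.
Qed.

End SquareRoot.

(** * Boundedness of symmetric operators; decomposition along a closed range *)

Section ClosedRange.
Set Implicit Arguments.
Unset Strict Implicit.
Context {R : realType} {H : hilbertType R}.
Implicit Types (x y z : H) (A X T : H -> H).
Local Open Scope complex_scope.

(* Gliding hump: if [X] is unbounded, choose [y n] with
   [nm (X (y n)) > 6 * 4 ^ n * n.+1 * nm (y n)]. One of [u] and [u + d n], where
   [d n] has norm [4 ^- n] and is parallel to [X (y n)], has a large product with
   [X (y n)], and all later modifications are too small to destroy this. The
   limit [l] then satisfies [nm (X l) >= n.+1] for all [n]. *)
Lemma Hellinger_Toeplitz X : linear X ->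
  (forall x y, rip (X x) y = rip x (X y)) ->
  exists2 M : R, 0 < M & forall x, nm (X x) <= M * nm x.
Proof.
move=> linX symX; apply: contrapT => unb.
(* The factors are chosen so that [e n / 6 * K n] is exactly [n.+1]. *)
pose K n : R := 6 * 4 ^+ n * n.+1%:R.
have K0 n : 0 < K n by rewrite !mulr_gt0 ?exprn_gt0 ?ltr0n.
have big n : exists y, K n * nm y < nm (X y).
  apply: contrapT => nbig; apply: unb; exists (K n) => // x.
  by rewrite leNgt; apply/negP => xK; apply: nbig; exists x.
have [y yK] := choice big.
pose e n : R := 4^-1 ^+ n.
have e0 n : 0 < e n by rewrite exprn_gt0 // invr_gt0.
have eS n : e n.+1 = e n / 4 by rewrite /e exprSr.
have z0 n : 0 < nm (X (y n)).
  by apply: le_lt_trans (yK n); rewrite mulr_ge0 ?nm_ge0 // ltW.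
pose d n := (e n / nm (X (y n)))%:C *: X (y n).
have nm_d n : nm (d n) = e n.
  rewrite nmZr ger0_norm ?divr_ge0 ?nm_ge0 ?(ltW (e0 n)) //.
  by rewrite divfK // lt0r_neq0.
have rip_d n : rip (d n) (X (y n)) = e n * nm (X (y n)).
  by rewrite ripZl ripxx expr2 mulrA divfK // lt0r_neq0.
pose fix u n := if n is m.+1 then
  if e m / 2 * nm (X (y m)) <= `|rip (u m) (X (y m))| then u m else u m + d m
  else 0.
have u_big n : e n / 2 * nm (X (y n)) <= `|rip (u n.+1) (X (y n))|.
  rewrite /=; case: ifPn => //; rewrite -ltNge ripDl rip_d.
  have := ler_normB (rip (u n) (X (y n)) + e n * nm (X (y n))) (rip (u n) (X (y n))).
  rewrite addrC addKr; have := ler_norm (e n * nm (X (y n))); lra.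
(* The multiple 4/3 makes consecutive differences equal to [e n]; the tail after [u n.+1] is then at
   most [e n / 3]. *)
have [] := @cvg_of_increments _ _ u (fun n => - (4 / 3 * e n)) 0.
- by move=> n; rewrite oppr_le0 mulr_ge0 ?divr_ge0 // ltW.
- move=> n /=; rewrite eS; have := e0 n; case: ifP => _.
    by rewrite subrr nm0; lra.
  by rewrite addrC addKr nm_d; lra.
move=> l _ ul.
have l_big n : n.+1%:R <= nm (X l).
  have y0 : 0 < nm (y n).
    rewrite lt_def nm_ge0 nm_eq0 andbT; apply: contraTneq (z0 n) => ->.
    by rewrite (lin0 linX) nm0 ltxx.
  (* The lower bound [e n / 2] minus the tail [e n / 3] leaves [e n / 6]. *)
  have h1 : e n / 6 * nm (X (y n)) <= nm (X l) * nm (y n).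
    apply: le_trans (rip_le_nm (X l) (y n)); rewrite symX.
    have := ul n.+1; rewrite sub0r opprK eS => tail.
    have := rip_le_nm (l - u n.+1) (X (y n)).
    have := ler_wpM2r (nm_ge0 (X (y n))) tail.
    have := ler_normB (rip l (X (y n))) (rip (l - u n.+1) (X (y n))).
    have -> : rip l (X (y n)) - rip (l - u n.+1) (X (y n)) = rip (u n.+1) (X (y n)).
      by rewrite -ripBl subKr.
    have := u_big n; lra.
  have h2 : e n / 6 * (K n * nm (y n)) <= e n / 6 * nm (X (y n)).
    by rewrite ler_wpM2l ?divr_ge0 ?ltW.
  have eK : e n / 6 * K n = n.+1%:R.
    have e4 : e n * 4 ^+ n = 1 by rewrite /e -exprMn mulVf ?expr1n ?pnatr_eq0.
    transitivity (e n * 4 ^+ n * n.+1%:R); last by rewrite e4 mul1r.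
    by rewrite /K; field.
  by rewrite -(ler_pM2r y0) (le_trans _ h1) // (le_trans _ h2) // mulrA eK.
by have := l_big (Num.trunc (nm (X l))); rewrite leNgt truncnS_gt.
Qed.

(* For [M] bounding [T] and [E = 1 - T / M], the sequence [E^n x] converges to
   a vector of the kernel of [T], while [x - E^n x] stays in the range of [T].
   Convergence holds because [n |-> <E^n x, x>] is nonincreasing. *)
Lemma closed_range_decomposition T : positive_operator T -> closed (range T) ->
  forall x, exists v, T (x - T v) = 0.
Proof.
move=> /positive_operatorP[linT [M M0 TM] symT posT] clT x.
pose E y := y - (M^-1)%:C *: T y.
have M'0 : 0 <= M^-1 by rewrite invr_ge0 ltW.
have linE : linear E.
  move=> a y z; rewrite /E linT scalerDr scalerBr opprD addrACA !scalerA.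
  by rewrite mulrC.
have symE y z : rip (E y) z = rip y (E z).
  by rewrite /E !(ripBl, ripBr, ripZl, ripZr) symT.
have formE y : rip (E y) y = nm y ^+ 2 - M^-1 * rip (T y) y.
  by rewrite /E ripBl ripxx ripZl.
have E1 y : rip (E y) y <= nm y ^+ 2 by rewrite formE lerBlDr lerDl mulr_ge0.
have posE y : 0 <= rip (E y) y.
  rewrite formE subr_ge0 mulrC ler_pdivrMr //.
  apply: le_trans (ler_norm _) _; apply: le_trans (rip_le_nm _ _) _.
  by rewrite expr2 -mulrA mulrC ler_wpM2l ?nm_ge0 // mulrC TM.
have EE y : nm (E y) ^+ 2 <= rip (E y) y.
  rewrite -[leRHS]mul1r; apply: nm_sqr_le_form => // z; by rewrite mul1r.
pose u n := iter n E x.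
have sym_iter n y z : rip (iter n E y) z = rip y (iter n E z).
  by elim: n y z => //= n IHn y z; rewrite symE IHn -iterSr.
(* Induction in steps of two: <E^(k+2) y, y> = <E^k (E y), E y> replaces [y] by [E y]. *)
have decr n y : rip (iter n.+1 E y) y <= rip (iter n E y) y.
  elim/ltn_ind: n y => -[|[|n]] IHn y /=.
  - by rewrite ripxx.
  - by rewrite symE ripxx.
  rewrite symE [leRHS]symE -!iterS !iterSr -iterSr; exact: IHn.
have decr' m n y : (m <= n)%N -> rip (iter n E y) y <= rip (iter m E y) y.
  move=> /subnK <-; elim: (n - m)%N => // k IHk; exact: le_trans (decr _ _) IHk.
have ru m n : rip (u n) (u m) = rip (iter (m + n) E x) x.
  by rewrite iterD [RHS]sym_iter.
(* With a_k = <E^k x, x>, |u_n - u_m|^2 = a_{2n} - 2 a_{m+n} + a_{2m}, and a_{m+n} >= a_{2n} for m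
   <= n. *)
have [] := @cvg_of_sqr_increments _ _ u (fun n => - rip (iter (n + n) E x) x) 0.
- by move=> n; rewrite oppr_le0 -ru ripxx sqr_ge0.
- move=> m n mn; rewrite -ripxx ripBl !ripBr !ru (addnC n m).
  by have := decr' (m + n)%N (n + n)%N x; rewrite leq_add2r => /(_ mn); lra.
move=> w uw.
have Ew : E w = w.
  have uS : u n.+1 @[n --> \oo] --> w by rewrite (cvg_shiftS u).
  apply: cvg_hilbert_unique _ uS.
  apply: (@cvg_bounded_operator _ _ E 1) uw => // y.
  by apply: nm_le_of_form => // z; rewrite mul1r.
have Tw : T w = 0.
  move/eqP: Ew; rewrite /E -subr_eq0 addrC addKr oppr_eq0 scaler_eq0 => /orP[|/eqP//].
  by rewrite (inj_eq (@complexI R) _ 0) invr_eq0 gt_eqF.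
have : range T (x - w).
  have xu : x - u n @[n --> \oo] --> x - w by apply: cvgB => //; exact: cvg_cst.
  apply: closed_cvg xu => //; apply: nearW => n.
  elim: n => [|n [v _ Tv]]; first by exists 0; rewrite // (lin0 linT) subrr.
  exists (v + (M^-1)%:C *: u n) => //.
  by rewrite (linD linT) (linZ linT) Tv /u /= /E opprB [RHS]addrCA [RHS]addrC.
by case=> v _ Tv; exists v; rewrite Tv subKr.
Qed.

End ClosedRange.

(** * Moore-Penrose inverse: uniqueness, then construction for positive operators *)

Section MoorePenrose.
Set Implicit Arguments.
Unset Strict Implicit.
Context {R : realType} {H : hilbertType R}.
Implicit Types (x y z : H) (A X Y T : H -> H).

Lemma inner_ext x y : (forall z, inner x z = inner y z) -> x = y.
Proof. by move=> xy; apply: rip_ext => z; rewrite /rip xy. Qed.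

(** Taking adjoints turns A B = B into B A = B and back. *)
Lemma self_adjoint_absorb A B : self_adjoint A -> self_adjoint B ->
  (forall x, A (B x) = B x) <-> (forall x, B (A x) = B x).
Proof.
move=> sA sB; split=> AB x; apply: inner_ext => z.
  by rewrite sB sA AB -sB.
by rewrite sA sB AB -sB.
Qed.

(** By absorption T X = (T X) (T Y) = T Y, likewise X T = Y T, and then X = X T X = Y T Y = Y. *)
Lemma is_moore_penrose_unique T X Y : is_moore_penrose T X ->
  is_moore_penrose T Y -> X = Y.
Proof.
move=> [_ TXT XTX sTX sXT] [_ TYT YTY sTY sYT].
have TX x : T (X x) = T (Y x).
  have /(self_adjoint_absorb sTY sTX)/(_ x) /= <- z :
    (T \o Y) ((T \o X) z) = (T \o X) z by exact: (congr1 (@^~ (X z)) TYT).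
  exact: (congr1 (@^~ (Y x)) TXT).
have XT x : X (T x) = Y (T x).
  have /(self_adjoint_absorb sYT sXT)/(_ x) /= <- z :
    (X \o T) ((Y \o T) z) = (X \o T) z by exact: (congr1 (X \o @^~ z) TYT).
  exact: (congr1 (Y \o @^~ x) TXT).
apply/funext => x.
have <- : X (T (X x)) = X x := congr1 (@^~ x) XTX.
by rewrite XT TX; exact: (congr1 (@^~ x) YTY).
Qed.

Lemma moore_penrose_positive T : positive_operator T -> closed (range T) ->
  [/\ positive_operator (moore_penrose T),
      forall x, T (moore_penrose T (T x)) = T x &
      forall x, moore_penrose T (T x) = T (moore_penrose T x)].
Proof.
move=> pT clT; have /positive_operatorP[linT [M M0 TM] symT posT] := pT.
have sT : self_adjoint T by case: pT.
have kerT x : T (T x) = 0 -> T x = 0.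
  move=> TTx; apply/eqP; rewrite -nm_eq0 -sqrf_eq0 -ripxx.
  by rewrite -symT TTx rip0l.
have ex_X x : exists y, (exists v, y = T v) /\ T (x - T y) = 0.
  have [v Tv] := closed_range_decomposition pT clT x.
  (* [T v] is the projection of [x] onto the range; decomposing [v] as well replaces it by a
     preimage [T w] that lies in the range. *)
  have [w Tw] := closed_range_decomposition pT clT v.
  exists (T w); split; first by exists w.
  have TTw : T (T w) = T v.
    by apply/esym/eqP; rewrite -subr_eq0 -(linB linT) Tw.
  by rewrite TTw.
have [X XP] := choice ex_X.
have ranX x : exists v, X x = T v by case: (XP x).
have TTX x : T (T (X x)) = T x.
  by apply/esym/eqP; rewrite -subr_eq0 -(linB linT); case: (XP x) => _ ->.
have T_inj v w : T (T v) = T (T w) -> T v = T w.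
  move=> h; apply/eqP; rewrite -subr_eq0 -(linB linT); apply/eqP/kerT.
  by rewrite !(linB linT) h subrr.
(* Injectivity of [T] on its range lets this equation determine [X x]; linearity and the identities
   for [X] follow from it. *)
have X_eq x v : T (T (T v)) = T x -> X x = T v.
  by have [w Xw] := ranX x => h; rewrite Xw; apply/T_inj/T_inj; rewrite -Xw TTX h.
have TXT x : T (X (T x)) = T x by apply: T_inj; rewrite TTX.
have linX : linear X.
  move=> a x y; have [v Xv] := ranX x; have [w Xw] := ranX y.
  rewrite Xv Xw -linT; apply: X_eq.
  by rewrite !linT -Xv -Xw !TTX.
have XT x : X (T x) = T (X x) by apply: X_eq; rewrite TTX.
have XTX x : X (T (X x)) = X x.
  by have [v Xv] := ranX x; rewrite {2}Xv; apply: X_eq; rewrite -Xv TTX.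
have sTX : self_adjoint (T \o X).
  (* [v - T (X v)] lies in the kernel of [T], hence is orthogonal to the range: T X is an orthogonal
     projection. *)
  have h u v : inner (T (X u)) v = inner (T (X u)) (T (X v)).
    by apply/eqP; rewrite -subr_eq0 -linearBr /= sT (XP v).2 linear0r.
  by move=> x y /=; rewrite (h x y) [LHS]hermC [RHS]hermC /= (h y x).
have sXT : self_adjoint (X \o T) by move=> x y /=; rewrite !XT; exact: sTX.
have sX : self_adjoint X.
  move=> x y; rewrite -{1}XTX [LHS]sXT /= XT -sT [LHS]sTX /= -XT.
  by rewrite XTX.
have symX : forall x y, rip (X x) y = rip x (X y) by exact/self_adjointP.
(* Boundedness of the pointwise chosen [X] comes from its linearity and symmetry. *)
have [N N0 XN] := Hellinger_Toeplitz linX symX.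
have bX : bounded_operator X by apply/bounded_operatorP; split=> //; exists N.
have mpX : is_moore_penrose T X.
  by split=> //; apply/funext => x /=.
have -> : moore_penrose T = X.
  rewrite /moore_penrose; case: xgetP => [Y _|/(_ X)//].
  by move=> mpY; exact: is_moore_penrose_unique mpY mpX.
split=> //; apply/positive_operatorP; split=> //; first by exists N.
by move=> x; rewrite -{1}XTX symX.
Qed.

End MoorePenrose.

(** * The Löwner order in terms of the spectral radius and the ranges *)

Theorem proposition2p4 (R : realType) (H : hilbertType R) (S T : H -> H)
    (S_pos : positive_operator S) (T_pos : positive_operator T)
    (T_closed : closed (range T)) :
  loewner_le S T <->
  spectral_radius (sqrt_operator S \o moore_penrose T \o sqrt_operator S) <= 1
  /\ range (sqrt_operator S) `<=` range T.
Proof.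
have [Q_pos QQ] : is_sqrt S (sqrt_operator S).
  rewrite /sqrt_operator; case: xgetP => // noQ.
  by have [Q SQ] := positive_sqrt_exists S_pos; case: (noQ Q).
have [X_pos TXT XT] := moore_penrose_positive T_pos T_closed.
move: (sqrt_operator S) (moore_penrose T) Q_pos QQ X_pos TXT XT.
move=> Q X Q_pos QQ X_pos TXT XT.
have {}QQ x : Q (Q x) = S x := congr1 (@^~ x) QQ.
have /positive_operatorP[linS [MS MS0 bS] symS posS] := S_pos.
have /positive_operatorP[linT [MT MT0 bT] symT posT] := T_pos.
have /positive_operatorP[linQ [MQ MQ0 bQ] symQ posQ] := Q_pos.
have /positive_operatorP[linX [MX MX0 bX] symX posX] := X_pos.
have nmQ x : nm (Q x) ^+ 2 = rip (S x) x by rewrite -QQ symQ ripxx.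
have A_pos : positive_operator (Q \o X \o Q).
  apply/positive_operatorP; split=> [a x y||x y|x] /=.
  - by rewrite linQ linX linQ.
  - exists (MQ * (MX * MQ)); first by rewrite !mulr_gt0.
    move=> x; apply: le_trans (bQ _) _; rewrite -!mulrA ler_wpM2l ?(ltW MQ0) //.
    by apply: le_trans (bX _) _; rewrite ler_wpM2l ?(ltW MX0).
  - by rewrite symQ symX symQ.
  - by rewrite symQ.
rewrite (spectral_radius_le A_pos ler01).
split=> [/positive_operatorP[_ _ _ ST]|[A1 ranQT]].
  have {}ST x : rip (S x) x <= rip (T x) x.
    by have := ST x; rewrite /= ripBl subr_ge0.
  have TXQ x : T (X (Q x)) = Q x.
    (* [y - T (X y)] is in the kernel of [T], and <S v, v> <= <T v, v> makes [Q] vanish there. *)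
    have QP y : Q (T (X y)) = Q y.
      apply/eqP; rewrite eq_sym -subr_eq0 -(linB linQ) -nm_eq0 -sqrf_eq0.
      rewrite nmQ eq_le -nmQ sqr_ge0 andbT nmQ; apply: le_trans (ST _) _.
      by rewrite (linB linT) -XT TXT subrr rip0l.
    (* Adjoint of Q T X = Q, since [T] and [X] commute. *)
    by apply: rip_ext => z; rewrite symT symX XT symQ QP -symQ.
  split=> [x /=|_ [x _ <-]]; last by exists (X (Q x)).
  set y := X (Q x); rewrite mul1r.
  have Ty : T y = Q x by exact: TXQ.
  have h1 : rip (Q y) x <= nm (Q y) * nm x.
    exact: le_trans (ler_norm _) (rip_le_nm _ _).
  have h2 : nm (Q y) ^+ 2 <= rip (Q y) x
    by rewrite nmQ (le_trans (ST y)) // Ty symQ ripC.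
  (* From |Q y|^2 <= |Q y| |x| one gets |Q y| <= |x|, hence <Q y, x> <= |x|^2. *)
  have := nm_ge0 x; have := nm_ge0 (Q y); nra.
have TXQ x : T (X (Q x)) = Q x.
  by have [|v _ <-] := ranQT (Q x); [exists x | rewrite TXT].
apply/positive_operatorP; split=> [a x y||x y|x] /=.
- by rewrite linS linT scalerBr opprD addrACA.
- exists (MT + MS); first by rewrite addr_gt0.
  by move=> x; apply: le_trans (nmD _ _) _; rewrite nmN mulrDl lerD.
- by rewrite ripBl ripBr symS symT.
rewrite ripBl subr_ge0 -nmQ.
set u := Q x; set w := X (Q u).
have Tw : T w = Q u by exact: TXQ.
have h1 : rip (T x) w ^+ 2 <= rip (T x) x * rip (T w) w.
  exact: CauchySchwarz_form.
have h2 : rip (T x) w = nm u ^+ 2 by rewrite symT Tw -symQ ripxx.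
have h3 : rip (T w) w <= nm u ^+ 2.
  by rewrite Tw ripC -symQ; have := A1 u; rewrite mul1r.
(* The last step divides by |u|^2; for u = 0 the claim is the positivity of [T]. *)
have [u0|u0] := eqVneq (nm u ^+ 2) 0; first by rewrite u0.
have u_gt0 : 0 < nm u ^+ 2 by rewrite lt_def u0 sqr_ge0.
rewrite -(ler_pM2r u_gt0) -expr2 -{1}h2; apply: le_trans h1 _.
by rewrite ler_wpM2l.
Qed.
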